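(* Let $p\in(1,\infty)$, and for $q\in(1,\infty)$ let $$I_p(q):=q^{1/p}\int_0^\infty\left|\frac{\sin_p x}{x}\right|^q\,\mathrm{d}x .$$ Then $$\lim_{q\to\infty} I_p(q)=\frac{1}{p}\,\Gamma\!\left(\frac1p\right)\,(p(p+1))^{1/p}.$$
   Context: For $p\in(1,\infty)$, define $F_p:[0,1]\to[0,\pi_p/2]$ by $F_p(y)=\int_0^y(1-t^p)^{-1/p}\,\mathrm{d}t$, where $\pi_p:=2F_p(1)=\frac{2\pi}{p\sin(\pi/p)}$. The generalised sine function $\sin_p$ is defined on $[0,\pi_p/2]$ as the inverse of $F_p$, and is extended to all of $\mathbb{R}$ as a $2\pi_p$-periodic function by the rules $\sin_p(-x)=-\sin_p(x)$ and $\sin_p(\frac{\pi_p}{2}-x)=\sin_p(\frac{\pi_p}{2}+x)$. $\Gamma$ is the Gamma function. The variable $q$ is real. *)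

(* Defs.v *)
From HB Require Import structures.
From mathcomp Require Import all_boot all_order all_algebra.
From mathcomp Require Import all_classical all_reals all_analysis.
From mathcomp Require Import measurable_realfun ring lra.

Set Implicit Arguments.
Unset Strict Implicit.
Unset Printing Implicit Defensive.

Import Order.TTheory GRing.Theory Num.Theory.
Import numFieldNormedType.Exports.

Local Open Scope classical_set_scope.
Local Open Scope ring_scope.

Section generalised_sine.
Context {R : realType}.
Implicit Types p q x y e : R.

Local Notation mu := (@lebesgue_measure R).

Definition F_p p y : R :=
  \int[mu]_(t in `[0, y]) ((1 - t `^ p) `^ (- p^-1)).

Definition pi_p p : R := 2 * F_p p 1.

Definition F_p_inv p : R -> R := 'pinv_(fun=> 0) `[0, 1] (F_p p).

(* Oddness and the reflection rule give sin_p (k pi_p + r) = (-1)^k sin_p r  *)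
(* for k an integer and |r| <= pi_p / 2; here k and r are computed from x.   *)
(* The lemmas sin_p_F, sin_pN, sin_p_refl and sin_pD2pi below state that     *)
(* sin_p inverts F_p on [0, 1] and satisfies the extension rules.            *)
Definition sin_p p x : R :=
  let k := Num.floor (x / pi_p p + 2^-1) in
  let r := x - k%:~R * pi_p p in
  (-1) ^ k * Num.sg r * F_p_inv p `|r|.

Definition Gamma a : R :=
  \int[mu]_(t in `]0, +oo[) (t `^ (a - 1) * expR (- t)).

(* The extended-real integral is used, so that divergence is not masked.     *)
Definition I_p p q : \bar R :=
  ((q `^ p^-1)%:E *
   \int[mu]_(x in `]0%R, +oo[) (`|sin_p p x / x| `^ q)%:E)%E.

Let f p t : R := (1 - t `^ p) `^ (- p^-1).

Lemma is_derive_powR_1B (b t : R) : t < 1 -> is_derive t 1 (fun t : R => (1 - t) `^ b)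
  (- (b * (1 - t) `^ (b - 1))).
Proof.
move=> t1; have t0 : 0 < 1 - t by lra.
have h := is_derive1_powR b t0.
have h2 : is_derive t 1 (fun t : R => 1 - t) (- 1).
  have := is_deriveB (@is_derive_cst R R R 1 t 1) (@is_derive_id R R t 1); rewrite sub0r; exact.
have := is_derive1_comp (f := fun u : R => u `^ b) (g := fun t => 1 - t) (x := t) h h2.
by rewrite mulrN1.
Qed.

Lemma integral_powR_1B_le p e : 1 < p -> 0 < e -> e < 1 ->
  (\int[mu]_(t in `[0%R, (1 - e)%R]) ((1 - t) `^ (- p^-1))%:E <= ((1 - p^-1)^-1)%:E)%E.
Proof.
move=> p1 e0 e1; have p0 : 0 < p by lra.
have a1 : p^-1 < 1 by rewrite invf_lt1.
pose b : R := 1 - p^-1; have b0 : 0 < b by rewrite subr_gt0.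
pose G t : R := - b^-1 * (1 - t) `^ b.
have dG (t : R) : t < 1 -> is_derive t 1 G ((1 - t) `^ (- p^-1)).
  move=> t1; have h := is_derive_powR_1B b t1.
  have -> : (1 - t) `^ (- p^-1) = - b^-1 *: (- (b * (1 - t) `^ (b - 1))).
    have -> : b - 1 = - p^-1 by rewrite /b; lra.
    by rewrite /GRing.scale /= mulrNN mulKf// gt_eqF.
  exact: is_deriveZ.
have cG (t : R) : t < 1 -> {for t, continuous G}.
  move=> t1; apply: differentiable_continuous; apply/derivable1_diffP.
  by have [] := dG _ t1.
have cf (t : R) : t < 1 -> {for t, continuous (fun t : R => (1 - t) `^ (- p^-1))}.
  move=> t1; apply: differentiable_continuous; apply/derivable1_diffP.
  by have [] := is_derive_powR_1B (- p^-1) t1.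
rewrite (@continuous_FTC2 _ _ G)//.
- rewrite -EFinB lee_fin /G subr0 powR1.
  have -> : 1 - (1 - e) = e by lra.
  rewrite -/b; have := powR_ge0 e b; have : 0 < b^-1 by rewrite invr_gt0.
  by nra.
- by lra.
- apply: continuous_in_subspaceT => t; rewrite inE/= in_itv/= => /andP[_ h].
  by apply: cf; lra.
- split.
  + by move=> t; rewrite in_itv/= => /andP[_ h]; have [] // := dG t _; lra.
  + by apply: cvg_at_right_filter; apply: cG; lra.
  + by apply: cvg_at_left_filter; apply: cG; lra.
- move=> t; rewrite in_itv/= => /andP[_ h].
  by rewrite derive1E; have [] // := dG t _; lra.
Qed.

Lemma measurable_f p (D : set R) : measurable D -> measurable_fun D (f p).
Proof.
move=> mD; apply: measurable_funTS.
apply: (measurableT_comp (measurable_powR _)).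
exact: measurable_funB.
Qed.

Lemma integrable_f p : 1 < p -> mu.-integrable `[0, 1] (EFin \o f p).
Proof.
move=> p1; have p0 : 0 < p by lra.
apply/integrableP; split; first by apply/measurable_EFinP; exact: measurable_f.
have E : (fun x => `|(EFin \o f p) x|)%E = EFin \o f p.
  by apply/funext => x; rewrite /= ger0_norm// powR_ge0.
rewrite E -integral_itv_bndo_bndc; last by apply/measurable_EFinP; exact: measurable_f.
pose e n : R := n.+2%:R^-1.
have e0 n : 0 < e n by rewrite invr_gt0.
have e1 n : e n < 1 by rewrite invf_lt1 ?ltr1n.
pose K n := `[0%R, 1 - e n]%classic : set R.
have -> : `[0%R, 1[%classic = \bigcup_n K n.
  apply/seteqP; split => x /=.
    rewrite in_itv/= => /andP[x0 x1].
    have h : 0 < 1 - x by lra.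
    have [n _ nh] := near_infty_natSinv_lt (PosNum h).
    have h2 : n.+1%:R^-1 < 1 - x := nh n (leqnn n).
    have h3 : e n < 1 - x.
      by apply: le_lt_trans h2; rewrite lef_pV2 ?posrE// ler_nat.
    by exists n => //; rewrite /K/= in_itv/= x0/=; lra.
  move=> [n _]; rewrite /K/= !in_itv/= => /andP[-> h].
  by have := e0 n; lra.
have mK n : measurable (K n) by exact: measurable_itv.
have mfK n : measurable_fun (K n) (EFin \o f p).
  by apply/measurable_EFinP; exact: measurable_f.
have cv : (\int[mu]_(x in K n) (f p x)%:E @[n --> \oo] -->
    \int[mu]_(x in \bigcup_n K n) (f p x)%:E)%E.
  apply: ge0_nondecreasing_set_cvg_integral => //.
  - move=> m n mn; apply/subsetPset => x; rewrite /K/= !in_itv/= => /andP[-> h].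
    have : e n <= e m by rewrite lef_pV2 ?posrE// ler_nat.
    by move=> ?/=; lra.
  - by move=> n x _ /=; rewrite lee_fin powR_ge0.
apply: (@le_lt_trans _ _ ((1 - p^-1)^-1)%:E); last by rewrite ltry.
rewrite -(cvg_lim _ cv)//; apply: lime_le; first by apply/cvg_ex; eexists; exact: cv.
near=> n; apply: le_trans (integral_powR_1B_le p1 (e0 n) (e1 n)).
apply: ge0_le_integral => //.
- exact: mK.
- by move=> x _; rewrite lee_fin powR_ge0.
- exact: mfK.
- apply/measurable_EFinP; apply: measurable_funTS.
  by apply: (measurableT_comp (measurable_powR _)); exact: measurable_funB.
- move=> x; rewrite /K/= in_itv/= => /andP[x0 xe].
  have x1 : x < 1 by have := e0 n; lra.
  have xx : x `^ p <= x.
    have [->|xN0] := eqVneq x 0; first by rewrite powR0// gt_eqF.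
    have xp : 0 < x by rewrite lt_def xN0.
    by rewrite ge1r_powR ?xp ?ltW.
  have A : 0 < (1 - x) `^ p^-1 by apply: powR_gt0; lra.
  have B : 0 < (1 - x `^ p) `^ p^-1 by apply: powR_gt0; lra.
  rewrite lee_fin /f !powRN lef_pV2 ?posrE//.
  by apply: ge0_ler_powR; rewrite ?nnegrE ?invr_ge0; lra.
Unshelve. all: by end_near. Qed.

Lemma F_p_lt p x y : 1 < p -> 0 <= x -> x < y -> y <= 1 -> F_p p x < F_p p y.
Proof.
move=> p1 x0 xy y1; have p0 : 0 < p by lra.
have i01 := integrable_f p1.
have iy : mu.-integrable `[0, y] (EFin \o f p).
  by apply: integrableS i01 => //; apply: subset_itvl; rewrite bnd_simp.
rewrite -subr_gt0 /F_p (@Rintegral_itvB _ (f p)) //; last by rewrite bnd_simp ltW.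
have ixy : mu.-integrable `]x, y] (EFin \o f p).
  by apply: integrableS iy => //; apply: subset_itvr; rewrite bnd_simp.
rewrite -Rintegral_itv_bndo_bndc; last first.
  by apply: integrableS ixy => //; apply: subset_itvl; rewrite bnd_simp.
apply: (@lt_le_trans _ _ (\int[mu]_(t in `]x, y[) (1 : R))).
  by rewrite Rintegral_cst//= lebesgue_measure_itv/= lte_fin xy -EFinB/=; lra.
apply: le_Rintegral => //.
- have c : mu.-integrable `[x, y] (EFin \o (fun=> 1 : R)).
    apply: continuous_compact_integrable; first exact: segment_compact.
    by apply: continuous_subspaceT => ?; exact: cvg_cst.
  by apply: integrableS c => //; apply: subset_itvW.
- by apply: integrableS ixy => //; apply: subset_itvl; rewrite bnd_simp.
- move=> t; rewrite /= in_itv/= => /andP[xt ty].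
  have t0 : 0 < t by lra.
  have t1 : t `^ p < 1.
    apply: (@le_lt_trans _ _ t); last lra.
    by rewrite ge1r_powR// ?t0/=; lra.
  rewrite /f powRN invf_ge1 ?powR_gt0 ?subr_gt0//.
  apply: (@le_trans _ _ ((1 : R) `^ p^-1)); last by rewrite powR1.
  apply: ge0_ler_powR; rewrite ?nnegrE ?invr_ge0; have := powR_ge0 t p; lra.
Qed.

Lemma F_p0 p : F_p p 0 = 0.
Proof. by rewrite /F_p set_itv1 Rintegral_set1. Qed.

Lemma pi_p_gt0 p : 1 < p -> 0 < pi_p p.
Proof.
move=> p1; rewrite /pi_p mulr_gt0//.
by rewrite -(F_p0 p) F_p_lt.
Qed.

Lemma F_p_surj p x : 1 < p -> 0 <= x <= pi_p p / 2 -> exists2 y, y \in `[0, 1] & F_p p y = x.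
Proof.
move=> p1 h; apply: (@IVT _ (F_p p)); rewrite ?ler01//.
  apply: (@parameterized_integral_continuous _ 0 1 (f p)) => //; exact: integrable_f.
rewrite F_p0; have := F_p_lt p1 (lexx 0) ltr01 (lexx 1); rewrite F_p0 => F1.
have e : pi_p p / 2 = F_p p 1 by rewrite /pi_p; lra.
rewrite min_l ?max_r ?(ltW F1)//.
by rewrite -e.
Qed.

Lemma sin_pE p (k : int) r : 1 < p -> `|r| <= pi_p p / 2 ->
  sin_p p (k%:~R * pi_p p + r) = (-1) ^ k * Num.sg r * F_p_inv p `|r|.
Proof.
move=> p1; have P0 := pi_p_gt0 p1; set P := pi_p p in P0 *.
rewrite ler_norml => /andP[r1].
rewrite /sin_p -/P mulrDl mulfK ?gt_eqF// -addrA.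
rewrite floorDzr ?intr_int// intrKfloor.
rewrite le_eqVlt => /predU1P[rE|r2].
  have -> : r / P + 2^-1 = 1 by rewrite rE; field; rewrite gt_eqF.
  rewrite floor1 intrD mulrDl mul1r opprD addrACA subrr add0r.
  have -> : r - P = - r by rewrite rE; lra.
  by rewrite normrN sgrN expfzDr ?oppr_eq0 ?oner_eq0// expr1z mulrN1 mulrNN.
have -> : Num.floor (r / P + 2^-1) = 0.
  apply/eqP; rewrite floor_eq; apply/andP; split.
    by rewrite -lerBlDr sub0r ler_pdivlMr//; lra.
  by rewrite -ltrBrDr ltr_pdivrMr//; lra.
by rewrite addr0 addrAC subrr add0r.
Qed.

Lemma pi_p_decomp p x : 1 < p -> exists k : int, exists r, x = k%:~R * pi_p p + r /\ `|r| <= pi_p p / 2.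
Proof.
move=> p1; have P0 := pi_p_gt0 p1; set P := pi_p p in P0 *.
pose k := Num.floor (x / P + 2^-1); exists k, (x - k%:~R * P); split; first lra.
have := floor_le (x / P + 2^-1); have := floorD1_gt (x / P + 2^-1); rewrite -/k intrD => a b.
have xE : x = (x / P) * P by rewrite mulfVK// gt_eqF.
rewrite ler_norml; apply/andP; split; rewrite xE -mulrBl.
  suff: - 2^-1 <= x / P - k%:~R by nra.
  lra.
suff: x / P - k%:~R <= 2^-1 by nra.
move: a; rewrite /=; lra.
Qed.

Lemma sin_p_F p y : 1 < p -> 0 <= y <= 1 -> sin_p p (F_p p y) = y.
Proof.
move=> p1 /andP[y0 y1].
have mono a b : 0 <= a -> a <= b -> b <= 1 -> F_p p a <= F_p p b.
  rewrite le_eqVlt => ?; rewrite le_eqVlt => /predU1P[->//|ab] b1.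
  by apply/ltW/F_p_lt => //; rewrite le_eqVlt.
have Fy0 : 0 <= F_p p y by rewrite -(F_p0 p) mono.
have Fy1 : F_p p y <= pi_p p / 2.
  have -> : pi_p p / 2 = F_p p 1 by rewrite /pi_p; lra.
  exact: mono.
have := @sin_pE p 0 (F_p p y) p1; rewrite mul0r add0r => ->; last by rewrite ger0_norm.
rewrite expr0z mul1r ger0_norm// /F_p_inv pinvKV; last by rewrite inE/= in_itv/= y0.
  move: y0; rewrite le_eqVlt => /predU1P[<-|y0]; first by rewrite mulr0.
  by rewrite gtr0_sg ?mul1r// -(F_p0 p) F_p_lt.
move=> a b; rewrite !inE/= !in_itv/= => /andP[a0 a1] /andP[b0 b1] ab.
have [h|h|//] := ltgtP a b.
  by have := F_p_lt p1 a0 h b1; rewrite ab ltxx.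
by have := F_p_lt p1 b0 h a1; rewrite ab ltxx.
Qed.

Lemma F_sin_p p x : 1 < p -> 0 <= x <= pi_p p / 2 -> F_p p (sin_p p x) = x.
Proof.
by move=> p1 /(F_p_surj p1)[y]; rewrite in_itv/= => y01 <-; rewrite sin_p_F.
Qed.

Lemma sin_pN p x : 1 < p -> sin_p p (- x) = - sin_p p x.
Proof.
move=> p1; have [k [r [-> h]]] := pi_p_decomp x p1.
have h' : `|- r| <= pi_p p / 2 by rewrite normrN.
rewrite opprD -mulNr -mulrNz (sin_pE _ p1 h') (sin_pE _ p1 h) normrN sgrN mulrN mulNr.
by rewrite -exprz_inv invrN1.
Qed.

Lemma sin_p_refl p x : 1 < p -> sin_p p (pi_p p / 2 - x) = sin_p p (pi_p p / 2 + x).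
Proof.
move=> p1; have [k [r [xE h]]] := pi_p_decomp (pi_p p / 2 + x) p1.
have -> : pi_p p / 2 - x = (1 - k)%:~R * pi_p p + (- r).
  have -> : x = k%:~R * pi_p p + r - pi_p p / 2 by lra.
  by rewrite intrB; lra.
have h' : `|- r| <= pi_p p / 2 by rewrite normrN.
rewrite xE (sin_pE _ p1 h') (sin_pE _ p1 h) normrN sgrN mulrN expfzDr ?oppr_eq0 ?oner_eq0//.
by rewrite expr1z mulN1r !mulNr opprK -exprz_inv invrN1.
Qed.

Lemma sin_pD2pi p x : 1 < p -> sin_p p (x + 2 * pi_p p) = sin_p p x.
Proof.
move=> p1; have [k [r [-> h]]] := pi_p_decomp x p1.
have -> : k%:~R * pi_p p + r + 2 * pi_p p = (k + 2)%:~R * pi_p p + r by rewrite intrD; lra.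
by rewrite !sin_pE// expfzDr ?oppr_eq0 ?oner_eq0// -exprnP sqrrN expr1n mulr1.
Qed.

End generalised_sine.

(* Main.v *)
(* The substitution x = (p (p + 1) t / q)^(1/p) turns I_p(q) into the constant
   (p (p + 1))^(1/p) / p times the integral of t^(1/p - 1) |sin_p x / x|^q over
   t > 0. Near 0, sin_p x / x = 1 - x^p / (p (p + 1)) + o(x^p), so the integrand
   tends to t^(1/p - 1) e^(-t), whose integral is Gamma(1/p). Passing to the
   limit is dominated convergence: with y = sin_p x, integrating
   (1 - s^p)^(-1/p) >= 1 + s^p / p gives x >= y + y^(p + 1) / (p (p + 1)), and
   hence |sin_p x / x|^p <= 1 / (1 + x^p / (p + 2)) for every x > 0, because
   |sin_p| at x equals sin_p at the distance from x to the lattice of zeros. *)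

Require Import Defs.
From mathcomp Require Import all_boot all_order all_algebra.
From mathcomp Require Import all_classical all_reals all_analysis.
From mathcomp Require Import measurable_realfun ring lra.
Set Implicit Arguments.
Unset Strict Implicit.
Unset Printing Implicit Defensive.
Import Order.TTheory GRing.Theory Num.Theory.
Import numFieldNormedType.Exports.
Local Open Scope classical_set_scope.
Local Open Scope ring_scope.

(** * Elementary inequalities for real powers *)

(** Concavity of [ln] between 1 + r w and 1 with weights 1/r and 1 - 1/r: the weighted mean of the
    two points is 1 + w. *)
Lemma powR_bernoulli (R : realType) (w r : R) : 0 <= w -> 1 <= r ->
  1 + r * w <= (1 + w) `^ r.
Proof.
move=> w0 r1; have r0 : 0 < r by lra.
have rw0 : 0 <= r * w by rewrite mulr_ge0// ltW.
have h0 : 0 <= r^-1 by rewrite invr_ge0 ltW.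
have h1 : r^-1 <= 1 by rewrite invf_le1.
have h : r^-1 * ln (1 + r * w) + (1 - r^-1) * ln 1 <=
    ln (r^-1 * (1 + r * w) + (1 - r^-1) * 1).
  by apply: (concave_ln (Itv01 h0 h1)); lra.
have e : r^-1 * (1 + r * w) + (1 - r^-1) * 1 = 1 + w by field; rewrite gt_eqF.
rewrite e ln1 mulr0 addr0 ler_pdivrMl// in h.
rewrite /powR gt_eqF; last lra.
rewrite -[X in X <= _](@lnK R) ?posrE; last lra.
by rewrite ler_expR.
Qed.

Lemma powR_1B_ge (R : realType) (b u : R) : 0 <= b -> 0 <= u -> u < 1 ->
  1 + b * u <= (1 - u) `^ (- b).
Proof.
move=> b0 u0 u1; rewrite /powR gt_eqF ?subr_gt0//.
apply: le_trans (expR_ge1Dx _); rewrite lerD2l mulNr -mulrN ler_wpM2l//.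
by rewrite lerNr; apply: (@le_ln1Dx R (- u)); lra.
Qed.

(** Since - ln (1 - u) = ln (1 + u / (1 - u)) <= u / (1 - u), the power is at most e^z with z = b u
    / (1 - u), and e^z <= 1 / (1 - z). Bounding [u] by [v] makes the slope independent of [u], so
    that the estimate can be integrated with u = t^p. *)
Lemma powR_1B_le (R : realType) (b u v : R) :
  0 <= b <= 1 -> 0 <= u -> u <= v -> v < 2^-1 ->
  (1 - u) `^ (- b) <= 1 + b / (1 - 2 * v) * u.
Proof.
move=> /andP[b0 b1] u0 uv v2.
have u1 : 0 < 1 - u by lra.
rewrite /powR gt_eqF//.
have hln : - ln (1 - u) <= u / (1 - u).
  rewrite -lnV ?posrE//.
  have e : (1 - u)^-1 = 1 + u / (1 - u) by field; rewrite gt_eqF.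
  rewrite [X in ln X]e.
  have : 0 <= u / (1 - u) by rewrite divr_ge0// ltW.
  by move=> h; apply: (@le_ln1Dx R (u / (1 - u))); lra.
set z := b * (u / (1 - u)).
have z1 : 0 < 1 - u - b * u by nra.
have zE : 1 - z = (1 - u - b * u) / (1 - u) by rewrite /z; field; rewrite gt_eqF.
have z0 : 0 < 1 - z by rewrite zE divr_gt0.
apply: (@le_trans _ _ (expR z)).
  by rewrite ler_expR mulNr -mulrN /z ler_wpM2l.
apply: (@le_trans _ _ (1 - z)^-1).
  rewrite -[expR z]invrK lef_pV2 ?posrE ?invr_gt0 ?expR_gt0// -expRN.
  exact: expR_ge1Dx.
rewrite zE invf_div.
have -> : (1 - u) / (1 - u - b * u) =
  1 + b / (1 - u - b * u) * u by field; rewrite gt_eqF.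
rewrite lerD2l ler_wpM2r// ler_wpM2l// lef_pV2 ?posrE//; nra.
Qed.

(** * Two-sided estimates of [F_p] by integrating bounds on its integrand *)

Section F_p_bounds.
Context {R : realType}.
Implicit Types (p b c x y : R).

Local Notation mu := (@lebesgue_measure R).

Lemma continuous_powR b x : 0 < x -> {for x, continuous (fun t : R => t `^ b)}.
Proof.
move=> x0; apply: differentiable_continuous; apply/derivable1_diffP.
by apply: derivable_powR; rewrite in_itv/= x0.
Qed.

(** One-sided because x = 0 is allowed: t^b equals 1 for negative [t]. *)
Lemma cvg_powR_at_right b x : 0 < b -> 0 <= x ->
  t `^ b @[t --> x^'+] --> x `^ b.
Proof.
move=> b0; rewrite le_eqVlt => /predU1P[<-|x0].
  by rewrite powR0 ?gt_eqF//; exact: powR_cvg0.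
by apply: cvg_at_right_filter; apply: continuous_powR.
Qed.

Lemma continuous_1DpowR p c x y : 0 < p -> 0 <= x -> x < y ->
  {within `[x, y], continuous (fun t => 1 + c * t `^ p)}.
Proof.
move=> p0 x0 xy; apply/(continuous_within_itvP _ xy); split.
- move=> t; rewrite in_itv/= => /andP[xt _].
  apply: cvgD; first exact: cvg_cst.
  by apply: cvgM; [exact: cvg_cst|apply: continuous_powR; lra].
- apply: cvgD; first exact: cvg_cst.
  by apply: cvgM; [exact: cvg_cst|exact: cvg_powR_at_right].
- apply: cvg_at_left_filter; apply: cvgD; first exact: cvg_cst.
  by apply: cvgM; [exact: cvg_cst|apply: continuous_powR; lra].
Qed.

Lemma integrable_1DpowR p c x y : 0 < p -> 0 <= x -> x < y ->
  mu.-integrable `]x, y[ (EFin \o (fun t => 1 + c * t `^ p)).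
Proof.
move=> p0 x0 xy; apply: (@integrableS _ _ _ mu `[x, y]%classic) => //.
  exact: subset_itvW.
apply: continuous_compact_integrable; first exact: segment_compact.
exact: continuous_1DpowR.
Qed.

Lemma Rintegral_1DpowR p c x y : 0 < p -> 0 <= x -> x < y ->
  \int[mu]_(t in `]x, y[) (1 + c * t `^ p) =
  y - x + c / (p + 1) * (y `^ (p + 1) - x `^ (p + 1)).
Proof.
move=> p0 x0 xy.
pose G t : R := t + c / (p + 1) * t `^ (p + 1).
have dG (t : R) : 0 < t -> is_derive t 1 G (1 + c * t `^ p).
  move=> t0.
  have -> : 1 + c * t `^ p = 1 + c / (p + 1) *: ((p + 1) * t `^ (p + 1 - 1)).
    rewrite addrK /GRing.scale/=; field; lra.
  apply: is_deriveD; apply: is_deriveZ; exact: is_derive1_powR.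
have := @continuous_FTC2 R (fun t => 1 + c * t `^ p) G x y xy.
rewrite integral_itv_bndoo; last first.
  by have /integrableP[] := @integrable_1DpowR p c x y p0 x0 xy.
rewrite /Rintegral => ->/=.
- by rewrite /G; ring.
- exact: continuous_1DpowR.
- split.
  + by move=> t; rewrite in_itv/= => /andP[xt _]; have [] // := dG t _; lra.
  + apply: cvgD; first exact: cvg_at_right_filter.
    by apply: cvgM; [exact: cvg_cst|apply: cvg_powR_at_right; lra].
  + apply: cvg_at_left_filter; apply: cvgD => //.
    by apply: cvgM; [exact: cvg_cst|apply: continuous_powR; lra].
- move=> t; rewrite in_itv/= => /andP[xt _].
  by rewrite derive1E; have [] // := dG t _; lra.
Qed.

(** The open interval leaves out t = 1, where the integrand takes the default value 0 and the
    pointwise lower bound 1 + t^p / p would fail. *)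
Lemma F_p_subE p x y : 1 < p -> 0 <= x -> x < y -> y <= 1 ->
  [/\ F_p p y - F_p p x = \int[mu]_(t in `]x, y[) ((1 - t `^ p) `^ (- p^-1)) &
  mu.-integrable `]x, y[ (EFin \o (fun t => (1 - t `^ p) `^ (- p^-1)))].
Proof.
move=> p1 x0 xy y1; have i01 := integrable_f p1.
have iy : mu.-integrable `[0, y] (EFin \o (fun t => (1 - t `^ p) `^ (- p^-1))).
  by apply: integrableS i01 => //; apply: subset_itvl; rewrite bnd_simp.
have ixy : mu.-integrable `]x, y[ (EFin \o (fun t => (1 - t `^ p) `^ (- p^-1))).
  by apply: integrableS iy => //; apply: subset_itv; rewrite bnd_simp.
split => //; rewrite /F_p Rintegral_itvB//; last by rewrite bnd_simp ltW.
by rewrite -Rintegral_itv_bndo_bndc.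
Qed.

(** Integrates [powR_1B_ge] at b = 1/p and u = t^p. The form with a difference also serves to
    compare [sin_p] at two points. *)
Lemma F_p_sub_ge p x y : 1 < p -> 0 <= x -> x <= y -> y <= 1 ->
  y - x + (y `^ (p + 1) - x `^ (p + 1)) / (p * (p + 1)) <= F_p p y - F_p p x.
Proof.
move=> p1 x0; rewrite le_eqVlt => /predU1P[<-|xy] y1; first by rewrite !subrr mul0r add0r.
have p0 : 0 < p by lra.
have [-> ixy] := F_p_subE p1 x0 xy y1.
have -> : (y `^ (p + 1) - x `^ (p + 1)) / (p * (p + 1)) =
  p^-1 / (p + 1) * (y `^ (p + 1) - x `^ (p + 1)) by field; lra.
rewrite -Rintegral_1DpowR//; apply: le_Rintegral => //; first exact: integrable_1DpowR.
move=> t; rewrite /= in_itv/= => /andP[xt ty].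
apply: powR_1B_ge; rewrite ?invr_ge0 ?powR_ge0//; first lra.
have <- : 1 `^ p = 1 :> R by rewrite powR1.
by apply: gt0_ltr_powR; rewrite ?nnegrE; lra.
Qed.

(** Integrates [powR_1B_le] at b = 1/p, u = t^p and v = y^p. The correction agrees to leading order
    with that of [F_p_sub_ge] at x = 0. *)
Lemma F_p_le p y : 1 < p -> 0 <= y -> y `^ p < 2^-1 ->
  F_p p y <= y * (1 + y `^ p / (p * (p + 1) * (1 - 2 * y `^ p))).
Proof.
move=> p1; rewrite le_eqVlt => /predU1P[<-|y0] yp; first by rewrite F_p0 mul0r.
have p0 : 0 < p by lra.
have y1 : y <= 1.
  rewrite leNgt; apply/negP => y1; have := @ler_powR R y (ltW y1) 0 p (ltW p0).
  by rewrite powRr0; lra.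
have [] := F_p_subE p1 (lexx 0) y0 y1; rewrite F_p0 subr0 => -> iy.
have -> : y * (1 + y `^ p / (p * (p + 1) * (1 - 2 * y `^ p))) =
    y - 0 + (p^-1 / (1 - 2 * y `^ p)) / (p + 1) * (y `^ (p + 1) - 0 `^ (p + 1)).
  rewrite powR0; last lra.
  rewrite -(@mulr_powRB1 _ y (p + 1)) ?addrK; [|lra|lra].
  by field; do ?(apply/andP; split); lra.
rewrite -Rintegral_1DpowR//; apply: le_Rintegral => //; first exact: integrable_1DpowR.
move=> t; rewrite /= in_itv/= => /andP[xt ty].
apply: powR_1B_le => //; rewrite ?powR_ge0 ?invr_ge0 ?invf_le1 ?(ltW p0) ?(ltW p1)//.
by apply: ge0_ler_powR; rewrite ?nnegrE; lra.
Qed.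

End F_p_bounds.

(** * Continuity of |sin_p| and bounds on |sin_p x / x| *)

Section sin_p_bounds.
Context {R : realType}.
Implicit Types (p q x y : R).

Lemma powRV x p : 0 <= x -> x^-1 `^ p = (x `^ p)^-1.
Proof. by move=> x0; rewrite -powR_inv1// powRAC powR_inv1// powR_ge0. Qed.

Lemma powR_le1 x p : 0 <= p -> 0 <= x <= 1 -> x `^ p <= 1.
Proof.
move=> p0 /andP[x0 x1]; have <- : 1 `^ p = 1 :> R by rewrite powR1.
by apply: ge0_ler_powR; rewrite ?nnegrE.
Qed.

(* k pi_p is the zero of sin_p nearest to x. *)
Lemma abs_sin_p_decomp p x : 1 < p -> exists (k : int) y,
  [/\ 0 <= y <= 1, `|sin_p p x| = y, F_p p y = `|x - k%:~R * pi_p p| &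
      forall j : int, `|x - k%:~R * pi_p p| <= `|x - j%:~R * pi_p p|].
Proof.
move=> p1; have P0 := pi_p_gt0 p1; have [k [r [xE rP]]] := pi_p_decomp x p1.
have rE : x - k%:~R * pi_p p = r by rewrite xE; ring.
have [|y y01 yE] := @F_p_surj _ p `|r| p1; first by rewrite normr_ge0.
move: y01; rewrite in_itv/= => y01.
exists k, y; rewrite rE; split => //.
(* The instance k = 0 of [sin_pE] at |r| expresses [y]; the instance at [x] differs from it only in
   sign. *)
- have := sin_p_F p1 y01; rewrite yE.
  have := @sin_pE _ p 0 `|r| p1; rewrite normr_id mul0r add0r expr0z mul1r => -> // h.
  have y0 : 0 <= y by case/andP: y01.
  rewrite -(ger0_norm y0) -h xE sin_pE// !normrM sgr_norm normr_sg.
  have -> : `|(-1) ^ k| = 1 :> R.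
    by case: (k) => n; rewrite /exprz ?normfV normrX normrN1 expr1n ?invr1.
  by rewrite normr_nat mul1r.
(* Distinct integers differ by at least 1, so the distance from [x] to another zero is at least pi_p
   - |r|, hence at least |r|. *)
- move=> j; have [->|jk] := eqVneq j k; first by rewrite rE.
  have -> : x - j%:~R * pi_p p = r + (k - j)%:~R * pi_p p.
    by rewrite xE intrD intrN; ring.
  have h : 1 <= `|(k - j)%:~R : R|.
    by rewrite -intr_norm ler1z -gtz0_ge1 normr_gt0 subr_eq0 eq_sym.
  rewrite [r + _]addrC; apply: le_trans (lerB_normD _ _).
  by rewrite normrM (gtr0_norm P0); nra.
Qed.

Lemma F_p_expand p x y : 1 < p -> 0 <= x -> x <= y -> y <= 1 ->
  y - x <= F_p p y - F_p p x.
Proof.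
move=> p1 x0 xy y1; apply: le_trans (F_p_sub_ge p1 x0 xy y1).
rewrite lerDl divr_ge0//; last by rewrite mulr_ge0; lra.
by rewrite subr_ge0; apply: ge0_ler_powR; rewrite ?nnegrE; lra.
Qed.

(** By [F_p_expand] the values of |sin_p| differ by at most the difference of the distances to the
    lattice of zeros, and distance to a set is 1-Lipschitz. The other sign follows by exchanging the
    points. *)
Lemma abs_sin_p_lipschitz p x x' : 1 < p -> `|sin_p p x| - `|sin_p p x'| <= `|x - x'|.
Proof.
move=> p1.
have [k [y [/andP[y0 y1] -> yF kx]]] := abs_sin_p_decomp x p1.
have [k' [y' [/andP[y0' y1'] -> yF' _]]] := abs_sin_p_decomp x' p1.
have [yy'|/ltW y'y] := leP y y'; first by have := normr_ge0 (x - x'); lra.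
apply: le_trans (F_p_expand p1 y0' y'y y1) _.
rewrite yF yF'; have := kx k'.
have := ler_normD (x - x') (x' - k'%:~R * pi_p p).
by rewrite addrA subrK; lra.
Qed.

Lemma continuous_abs_sin_p p : 1 < p -> continuous (fun x => `|sin_p p x|).
Proof.
move=> p1 x; apply/cvgrPdist_le => /= e e0; near=> t.
have h : `|x - t| <= e.
  by near: t; apply: cvgr_dist_le.
apply: le_trans h; rewrite ler_norml abs_sin_p_lipschitz// andbT.
by rewrite lerNl opprB distrC abs_sin_p_lipschitz.
Unshelve. all: by end_near. Qed.

(** The zero 0 is at distance [x], so the nearest zero gives F_p y <= x. Raising y (1 + v) <= x to
    the power [p] and applying Bernoulli yields Y (1 + Y / (p + 1)) <= X for Y = y^p and X = x^p. *)
Lemma sin_p_ratio_bound p x : 1 < p -> 0 < x ->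
  `|sin_p p x / x| `^ p <= (1 + x `^ p / (p + 2))^-1.
Proof.
move=> p1 x0; have p0 : 0 < p by lra.
rewrite normrM normfV (gtr0_norm x0) powRM ?powRV ?invr_ge0 ?(ltW x0)//.
have [k [y [/andP[y0 y1] -> yF /(_ 0)]]] := abs_sin_p_decomp x p1.
rewrite mul0r subr0 (gtr0_norm x0) -yF => Fx.
have Yge0 := powR_ge0 y p; have X0 := powR_gt0 p x0.
have Y1 : y `^ p <= 1 by rewrite powR_le1 ?y0// ltW.
have := F_p_sub_ge p1 (lexx 0) y0 y1; rewrite F_p0 !subr0 powR0 ?subr0; last lra.
have -> : y + y `^ (p + 1) / (p * (p + 1)) = y * (1 + y `^ p / (p * (p + 1))).
  rewrite -(@mulr_powRB1 _ y (p + 1)) ?addrK; [ring|lra|lra].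
set v := y `^ p / (p * (p + 1)) => h.
have v0 : 0 <= v by rewrite /v divr_ge0// mulr_ge0; lra.
have hX : y `^ p * (1 + y `^ p / (p + 1)) <= x `^ p.
  have -> : y `^ p / (p + 1) = p * v by rewrite /v; field; lra.
  apply: (@le_trans _ _ ((y * (1 + v)) `^ p)).
    rewrite powRM//; last lra.
    by rewrite ler_wpM2l// powR_bernoulli// ltW.
  by apply: ge0_ler_powR; rewrite ?nnegrE ?mulr_ge0 ?(ltW p0)// ?(ltW x0)//; lra.
rewrite ler_pdivrMr// ler_pdivlMl; last by rewrite ltr_pwDl// divr_ge0; lra.
set X := x `^ p in X0 hX *; set Y := y `^ p in Yge0 Y1 hX *.
have j0 : 0 < (p + 2)^-1 by rewrite invr_gt0; lra.
have Yj : Y / (p + 2) <= 1 by rewrite ler_pdivrMr; lra.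
(* Replacing p + 1 by p + 2 leaves a remainder with the factor Y (1 - Y), nonnegative because Y <=
   1; this turns the quadratic bound in [Y] into one linear in [Y]. *)
have e : (1 + Y / (p + 1)) * (1 - Y / (p + 2)) = 1 + Y * (1 - Y) / ((p + 1) * (p + 2)).
  by field; apply/andP; split; lra.
have e2 : 0 <= Y * (1 - Y) / ((p + 1) * (p + 2)) by rewrite divr_ge0// mulr_ge0; lra.
have : Y * (1 + Y / (p + 1)) * (1 - Y / (p + 2)) <= X * (1 - Y / (p + 2)).
  by rewrite ler_wpM2r//; lra.
rewrite -mulrA e mulrDr mulr1.
have := mulr_ge0 Yge0 e2.
have -> : (1 + X / (p + 2)) * Y = Y + X * (Y / (p + 2)) by ring.
by rewrite mulrBr mulr1; lra.
Qed.

(** Both exponents are - q X / c times a factor tending to 1 as [X] tends to 0. The lower bound uses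
    1 + w <= e^w, the upper one 1 / (1 + v) = 1 - v / (1 + v) <= e^(- v / (1 + v)). *)
Lemma sin_p_ratio_powR_bounds p q x (c := p * (p + 1)) (X := x `^ p) :
  1 < p -> 0 < q -> 0 < x <= pi_p p / 2 ->
  X < 2^-1 ->
  expR (- (q * X / c) / (1 - 2 * X)) <= `|sin_p p x / x| `^ q <=
  expR (- (q * X / c) * expR (- (p * (X / (c * (1 - 2 * X))))) / (1 + X / c)).
Proof.
move=> p1 q0 /andP[x0 xP] X2; have p0 : 0 < p by lra.
have [y] := @F_p_surj _ p x p1 ltac:(by rewrite ltW).
rewrite in_itv/= => /andP[y0 y1] Fy.
have sE : sin_p p x = y by rewrite -Fy sin_p_F ?y0.
have yx : y <= x by have := F_p_expand p1 (lexx 0) y0 y1; rewrite F_p0 !subr0 Fy.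
have c0 : 0 < c by rewrite mulr_gt0; lra.
have X0 : 0 < X by exact: powR_gt0.
have Yge0 := powR_ge0 y p.
have YX : y `^ p <= X by apply: ge0_ler_powR; rewrite ?nnegrE; lra.
have lo := F_p_sub_ge p1 (lexx 0) y0 y1.
have up := F_p_le p1 y0 ltac:(lra).
move: lo up; rewrite Fy F_p0 !subr0 powR0 ?subr0; last lra.
rewrite -/c.
have -> : y + y `^ (p + 1) / c = y * (1 + y `^ p / c).
  rewrite -(@mulr_powRB1 _ y (p + 1)) ?addrK; [ring|lra|lra].
set Y := y `^ p in Yge0 YX *; set w := Y / (c * _) => lo up.
set w' := X / (c * _).
have w0 : 0 <= w by rewrite /w divr_ge0// mulr_ge0; lra.
have ww' : w <= w'.
  apply: ler_pM => //; first by rewrite invr_ge0 mulr_ge0; lra.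
  by rewrite lef_pV2 ?posrE ?mulr_gt0 ?ler_wpM2l; lra.
have yx0 : 0 <= y / x by rewrite divr_ge0// ltW.
have rlo : expR (- w') <= y / x.
  apply: (@le_trans _ _ (expR (- w))); first by rewrite ler_expR; lra.
  rewrite ler_pdivlMr//; apply: le_trans (_ : expR (- w) * (y * expR w) <= _).
    rewrite ler_wpM2l ?expR_ge0//; apply: le_trans up _.
    by rewrite ler_wpM2l// expR_ge1Dx.
  by rewrite mulrCA -expRD addNr expR0 mulr1.
(* As Y = (y / x)^p X, the lower bound on the ratio feeds back into the upper one, which then
   depends on [X] alone. *)
have Y0 : expR (- (p * w')) * X <= Y.
  have -> : expR (- (p * w')) = expR (- w') `^ p by rewrite -expRM mulNr mulrC.
  have -> : Y = (y / x) `^ p * X.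
    rewrite powRM ?invr_ge0 ?(ltW x0)// powRV ?(ltW x0)// mulfVK// gt_eqF//.
  rewrite ler_wpM2r ?(ltW X0)//.
  by apply: ge0_ler_powR; rewrite ?nnegrE ?expR_ge0// ltW.
set v := Y / c in lo *.
have v0 : 0 <= v by rewrite /v divr_ge0// ltW.
have rup : y / x <= expR (- (v / (1 + v))).
  rewrite ler_pdivrMr//; apply: le_trans (_ : (1 - v / (1 + v)) * x <= _).
    have -> : 1 - v / (1 + v) = (1 + v)^-1 by field; lra.
    by rewrite ler_pdivlMl; [rewrite mulrC|lra].
  by rewrite ler_wpM2r ?(ltW x0)// expR_ge1Dx.
rewrite sE ger0_norm//; apply/andP; split.
- apply: le_trans (_ : expR (- w') `^ q <= _); last first.
    by apply: ge0_ler_powR; rewrite ?nnegrE ?expR_ge0// ltW.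
  rewrite -expRM ler_expR le_eqVlt; apply/orP; left; apply/eqP.
  by rewrite /w'; field; apply/andP; split; lra.
- apply: le_trans (_ : expR (- (v / (1 + v))) `^ q <= _).
    by apply: ge0_ler_powR; rewrite ?nnegrE ?expR_ge0// ltW.
  rewrite -expRM ler_expR.
  set E := expR _ in Y0 *; have E0 : 0 <= E by exact: expR_ge0.
  have -> : - (q * X / c) * E / (1 + X / c) = - (q * ((E * X / c) / (1 + X / c))) by ring.
  rewrite mulNr lerN2 [leRHS]mulrC ler_wpM2l ?(ltW q0)//.
  (* The numerator is compared through E X <= Y, the denominator through Y <= X. *)
  apply: ler_pM.
  + by apply: divr_ge0; [apply: mulr_ge0 => //; exact: ltW|exact: ltW].
  + by rewrite invr_ge0 addr_ge0//; apply: divr_ge0; exact: ltW.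
  + by rewrite /v ler_wpM2r ?invr_ge0// ltW.
  + have := @ler_wpM2r R c^-1 ltac:(by rewrite invr_ge0 ltW) _ _ YX.
    by rewrite -/v => vX; rewrite lef_pV2 ?posrE; lra.
Qed.

End sin_p_bounds.

(** * Integrals over the positive half-line *)

Section integral_0y.
Context {R : realType}.
Local Notation mu := (@lebesgue_measure R).
Implicit Types (f G : R -> R) (u v : R^nat) (b c : R).

Lemma measurable_fun_0y f : {in `]0, +oo[, continuous f} ->
  measurable_fun (`]0, +oo[%classic : set R) f.
Proof.
move=> cf; apply: open_continuous_measurable_fun; first exact: interval_open.
by move=> x; rewrite inE => /cf.
Qed.

(** Monotone convergence along compact intervals exhausting the half-line. It carries the
    fundamental theorem and substitution over from compact intervals, with infinite values
    allowed. *)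
Lemma cvg_integral_0y f u v :
  nonincreasing_seq u -> nondecreasing_seq v -> (forall n, 0 < u n) ->
  (forall x, 0 < x -> exists n, u n <= x <= v n) ->
  {in `]0, +oo[, continuous f} -> (forall x, 0 < x -> 0 <= f x) ->
  (\int[mu]_(x in `[u n, v n]) (f x)%:E @[n --> \oo] -->
   \int[mu]_(x in `]0%R, +oo[) (f x)%:E)%E.
Proof.
move=> ndu ndv u0 uv cf f0.
have -> : `]0, +oo[%classic = \bigcup_n `[u n, v n]%classic.
  apply/seteqP; split => x /=.
    by rewrite in_itv/= andbT => /uv[n h]; exists n => //=; rewrite in_itv.
  move=> [n _]/=; rewrite !in_itv/= andbT => /andP[+ _].
  exact: lt_le_trans.
apply: ge0_nondecreasing_set_cvg_integral => //.
- move=> m n mn; apply/subsetPset; apply: subset_itv; rewrite bnd_simp.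
    exact: ndu.
  exact: ndv.
- move=> n; apply: measurable_funS (measurable_itv `]0%R, +oo[) _ _.
    by apply: subset_itv; rewrite bnd_simp.
  by apply/measurable_EFinP; exact: measurable_fun_0y.
- move=> n x /=; rewrite in_itv/= => /andP[ux _].
  by rewrite lee_fin f0//; exact: lt_le_trans ux.
Qed.

Let u0 : R^nat := fun n => n.+1%:R^-1.
(** Starting at 2 gives u0 n <= 1 < v0 n even for n = 0, so the intervals are never degenerate. *)
Let v0 : R^nat := fun n => n.+2%:R.

Let u0_gt0 n : 0 < u0 n. Proof. by rewrite /u0 invr_gt0. Qed.

Let nd_u0 : nonincreasing_seq u0.
Proof. by move=> m n mn; rewrite /u0 lef_pV2 ?posrE// ler_nat. Qed.

Let nd_v0 : nondecreasing_seq v0.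
Proof. by move=> m n mn; rewrite /v0 ler_nat. Qed.

Let uv0 (x : R) : 0 < x -> exists n, u0 n <= x <= v0 n.
Proof.
move=> x0; have [n _ /(_ n (leqnn n)) nh] := near_infty_natSinv_lt (PosNum x0).
exists (maxn n (Num.trunc x)); rewrite /u0 /v0; apply/andP; split.
  apply: le_trans (ltW nh); rewrite lef_pV2 ?posrE// ler_nat ltnS.
  exact: leq_maxl.
apply: (@le_trans _ _ (Num.trunc x).+1%:R); last by rewrite ler_nat ltnS leqW ?leq_maxr.
by apply/ltW/truncnS_gt.
Qed.

(** The substitution x = c t^b is made on each [u0 n, v0 n]; these intervals and their images both
    exhaust the half-line, so both sides converge. *)
Lemma integral_powR_subst c b G : 0 < c -> 0 < b ->
  {in `]0, +oo[, continuous G} -> (forall x, 0 < x -> 0 <= G x) ->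
  (\int[mu]_(x in `]0%R, +oo[) (G x)%:E =
   \int[mu]_(t in `]0%R, +oo[) (G (c * t `^ b) * (c * b * t `^ (b - 1)))%:E)%E.
Proof.
move=> c0 b0 cG G0.
pose F (t : R) := c * t `^ b; pose dF (t : R) := c * b * t `^ (b - 1).
have F0 (t : R) : 0 < t -> 0 < F t by move=> t0; rewrite mulr_gt0// powR_gt0.
have iF (t : R) : 0 < t -> is_derive t 1 F (dF t).
  move=> t0; rewrite /dF -mulrA; apply: is_deriveZ; exact: is_derive1_powR.
have cF (t : R) : 0 < t -> {for t, continuous F}.
  move=> t0; apply: differentiable_continuous; apply/derivable1_diffP.
  by have [] := iF _ t0.
have cdF (t : R) : 0 < t -> {for t, continuous dF}.
  move=> t0; apply: cvgM; first exact: cvg_cst.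
  exact: continuous_powR.
have F'E (t : R) : 0 < t -> (derive1 F) t = dF t.
  by move=> t0; rewrite derive1E; have [] := iF _ t0.
have cF' (t : R) : 0 < t -> {for t, continuous (derive1 F)}.
  move=> t0; rewrite /prop_for /continuous_at F'E//.
  have := cdF t t0; apply: cvg_trans; apply: near_eq_cvg.
  near=> z; rewrite F'E//; near: z; exact: lt_nbhsr.
have ndF (x y : R) : 0 < x -> x < y -> F x < F y.
  by move=> x0 xy; rewrite ltr_pM2l//; apply: gt0_ltr_powR; rewrite ?nnegrE; lra.
have leF (x y : R) : 0 < x -> x <= y -> F x <= F y.
  by move=> x0; rewrite le_eqVlt => /predU1P[->//|xy]; apply/ltW/ndF.
have A : (\int[mu]_(x in `[F (u0 n), F (v0 n)]) (G x)%:E @[n --> \oo] -->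
   \int[mu]_(x in `]0%R, +oo[) (G x)%:E)%E.
  apply: (@cvg_integral_0y _ (F \o u0) (F \o v0)) => //.
  - by move=> m n mn /=; apply: leF => //; exact: nd_u0.
  - by move=> m n mn /=; apply: leF; [rewrite /v0|exact: nd_v0].
  - by move=> n /=; exact: F0.
  (* The point (x / c)^(1/b) is the preimage of [x] under [F]. *)
  - move=> x x0; have z0 : 0 < (x / c) `^ b^-1 by rewrite powR_gt0// divr_gt0.
    have xE : x = F ((x / c) `^ b^-1).
      rewrite /F -powRrM mulVf ?gt_eqF// powRr1 ?divr_ge0 ?ltW//.
      by rewrite mulrC divfK// gt_eqF.
    have [n /andP[n1 n2]] := uv0 z0; exists n => /=.
    by rewrite xE !leF.
have B : (\int[mu]_(t in `[u0 n, v0 n]) (G (F t) * dF t)%:E @[n --> \oo] -->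
   \int[mu]_(x in `]0%R, +oo[) (G (F x) * dF x)%:E)%E.
  apply: (@cvg_integral_0y (fun t => G (F t) * dF t) u0 v0) => //.
  - move=> x; rewrite in_itv/= andbT => x0; apply: cvgM; last exact: cdF.
    apply: continuous_comp; first exact: cF.
    by apply: cG; rewrite in_itv/= F0.
  - by move=> x x0; rewrite mulr_ge0 ?G0 ?F0// mulr_ge0 ?powR_ge0// ltW// mulr_gt0.
suff E n : (\int[mu]_(x in `[F (u0 n), F (v0 n)]) (G x)%:E =
    \int[mu]_(t in `[u0 n, v0 n]) (G (F t) * dF t)%:E)%E.
  by rewrite -(cvg_lim _ A)// (eq_fun E) (cvg_lim _ B).
have un := u0_gt0 n.
have uv : u0 n <= v0 n.
  apply: (@le_trans _ _ 1); first by rewrite /u0 invf_le1// ler1n.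
  by rewrite /v0 ler1n.
rewrite (@integration_by_substitution_increasing _ F G (u0 n) (v0 n))//.
- apply: eq_integral => x; rewrite inE/= in_itv/= => /andP[h _].
  by rewrite !fctE F'E// (lt_le_trans un h).
- move=> x y; rewrite !in_itv/= => /andP[h _] _; apply: ndF.
  exact: lt_le_trans h.
- move=> x; rewrite in_itv/= => /andP[h _]; apply: cF'.
  exact: lt_trans h.
- apply/cvg_ex; exists ((derive1 F) (u0 n)); apply: cvg_at_right_filter.
  exact: cF'.
- apply/cvg_ex; exists ((derive1 F) (v0 n)); apply: cvg_at_left_filter.
  by apply: cF'; rewrite /v0.
- split.
  + move=> x; rewrite in_itv/= => /andP[h _].
    by have [] := iF x (lt_trans un h).
  + by apply: cvg_at_right_filter; exact: cF.
  + by apply: cvg_at_left_filter; apply: cF; rewrite /v0.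
- apply: continuous_in_subspaceT => x; rewrite inE/= in_itv/= => /andP[h _].
  by apply: cG; rewrite in_itv/= andbT; apply: lt_le_trans h; exact: F0.
Unshelve. all: by end_near. Qed.

(** With b = 1/p this is, up to a constant, the dominating function for the limit. Its integrals
    over compact intervals stay below 1/b because the primitive takes values between 0 and 1/b. *)
Lemma integrable_powR_0y (b : R) : 0 < b ->
  mu.-integrable `]0, +oo[ (EFin \o (fun t => t `^ (b - 1) * (1 + t) `^ (- b - 1))).
Proof.
move=> b0.
pose h (t : R) := t `^ (b - 1) * (1 + t) `^ (- b - 1).
(* H is a bounded primitive of h, namely (t / (1 + t))^b / b. *)
pose H (t : R) := b^-1 * (t `^ b * (1 + t) `^ (- b)).
have iH (t : R) : 0 < t -> is_derive t 1 H (h t).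
  move=> t0.
  have t1 : 0 < 1 + t by lra.
  have d1 : is_derive t 1 (fun t : R => (1 + t) `^ (- b)) (- b * (1 + t) `^ (- b - 1)).
    have h1 : is_derive t 1 (fun t : R => 1 + t) 1.
      have := is_deriveD (@is_derive_cst R R R 1 t 1) (@is_derive_id R R t 1).
      by rewrite add0r; exact.
    have h2 := is_derive1_powR (- b) t1.
    have := is_derive1_comp (f := fun u : R => u `^ (- b))
      (g := fun t => 1 + t) (x := t) h2 h1.
    by rewrite mulr1.
  have d0 := is_derive1_powR b t0.
  have d := is_deriveZ b^-1 (is_deriveM d0 d1).
  apply: is_derive_eq d _; rewrite /h /GRing.scale/=.
  have -> : (1 + t) `^ (- b) = (1 + t) * (1 + t) `^ (- b - 1).
    have e : - b = 1 + (- b - 1) by ring.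
    rewrite [in LHS]e powRD; last by rewrite (gt_eqF t1) implybT.
    by rewrite powRr1// ltW.
  have -> : t `^ b = t * t `^ (b - 1) by rewrite mulr_powRB1// ltW.
  by field; rewrite gt_eqF.
have ch (t : R) : 0 < t -> {for t, continuous h}.
  move=> t0; apply: cvgM; first exact: continuous_powR.
  apply: (@continuous_comp _ _ _ (fun t : R => 1 + t) (fun x : R => x `^ (- b - 1))).
    by apply: cvgD; [exact: cvg_cst|exact: cvg_id].
  by apply: continuous_powR; lra.
have cH (t : R) : 0 < t -> {for t, continuous H}.
  move=> t0; apply: differentiable_continuous; apply/derivable1_diffP.
  by have [] := iH _ t0.
have cch : {in `]0, +oo[, continuous h} by move=> x; rewrite in_itv/= andbT => /ch.
have h0 (t : R) : 0 <= h t by rewrite mulr_ge0 ?powR_ge0.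
apply/integrableP; split; first by apply/measurable_EFinP; exact: measurable_fun_0y.
have -> : (fun t => `|(EFin \o h) t|)%E = EFin \o h.
  by apply/funext => t; rewrite /= ger0_norm.
have cv := @cvg_integral_0y h u0 v0 nd_u0 nd_v0 u0_gt0 uv0 cch (fun t _ => h0 t).
apply: (@le_lt_trans _ _ (b^-1)%:E); last by rewrite ltry.
rewrite -(cvg_lim _ cv)//; apply: lime_le; first by apply/cvg_ex; eexists; exact: cv.
apply: nearW => n; have un := u0_gt0 n.
have H0 (t : R) : 0 <= H t by rewrite mulr_ge0 ?invr_ge0 ?(ltW b0)// mulr_ge0 ?powR_ge0.
have H1 (t : R) : 0 < t -> H t <= b^-1.
  move=> t0; rewrite /H ger_pMr ?invr_gt0// powRN.
  rewrite ler_pdivrMr; last by apply: powR_gt0; lra.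
  rewrite mul1r; apply: ge0_ler_powR; rewrite ?nnegrE; lra.
have uv : u0 n < v0 n.
  by apply: (@le_lt_trans _ _ 1); [rewrite /u0 invf_le1// ler1n|rewrite /v0 ltr1n].
rewrite (@continuous_FTC2 _ h H)//.
- by rewrite -EFinB lee_fin; have := H0 (u0 n); have := H1 (v0 n) (lt_trans un uv); lra.
- apply: continuous_in_subspaceT => t; rewrite inE/= in_itv/= => /andP[ut _].
  by apply: ch; exact: lt_le_trans ut.
- split.
  + move=> t; rewrite in_itv/= => /andP[ut _].
    by have [] := iH t (lt_trans un ut).
  + by apply: cvg_at_right_filter; exact: cH.
  + by apply: cvg_at_left_filter; apply: cH; exact: lt_trans uv.
- move=> t; rewrite in_itv/= => /andP[ut _].
  by rewrite derive1E; have [] := iH t (lt_trans un ut).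
Qed.

End integral_0y.

(** * The rescaled integral and its limit *)

Section scaled_integrand.
Context {R : realType}.
Local Notation mu := (@lebesgue_measure R).
Implicit Types (p q t x : R).

(* The norm matters: x `^ q = 1 for x < 0, so x `^ q is discontinuous at 0. *)
Lemma continuous_norm_powR q : 0 < q -> continuous (fun x : R => `|x| `^ q).
Proof.
move=> q0 x; have [->|xN0] := eqVneq x 0.
  rewrite /continuous_at normr0 powR0 ?gt_eqF//; apply/cvgrPdist_le => /= e e0.
  near=> y; rewrite sub0r normrN ger0_norm ?powR_ge0//.
  rewrite -[leRHS]powRr1 ?(ltW e0)// -(@mulVf _ q) ?gt_eqF// powRrM.
  apply: ge0_ler_powR; rewrite ?nnegrE ?powR_ge0 ?(ltW q0)//.
  near: y; apply: (@cvgr0_norm_le _ _ _ _ _ id) => //.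
  by rewrite powR_gt0.
apply: (@continuous_comp _ _ _ (fun x : R => `|x|) (fun x : R => x `^ q)).
  exact: norm_continuous.
by apply: continuous_powR; rewrite normr_gt0.
Unshelve. all: by end_near. Qed.

Lemma continuous_sinc_p_powR p q : 1 < p -> 0 < q ->
  {in `]0, +oo[, continuous (fun x => `|sin_p p x / x| `^ q)}.
Proof.
move=> p1 q0 x; rewrite in_itv/= andbT => x0.
(* The outer norm allows [sin_p] to be replaced by |sin_p|, whose continuity is established. *)
have -> : (fun x => `|sin_p p x / x| `^ q) =
    (fun x => `|x| `^ q) \o (fun x => `|sin_p p x| / x).
  by apply/funext => y /=; rewrite (normrM (sin_p p y)) (normrM `|sin_p p y|) normr_id.
apply: continuous_comp; last exact: continuous_norm_powR.
apply: cvgM; first exact: continuous_abs_sin_p.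
by apply: inv_continuous; rewrite gt_eqF.
Qed.

(** Written as a product to match the form c t^b in [integral_powR_subst]. *)
Definition scaled_arg p q t := (p * (p + 1) / q) `^ p^-1 * t `^ p^-1.

Definition scaled_integrand p q t :=
  t `^ (p^-1 - 1) * `|sin_p p (scaled_arg p q t) / scaled_arg p q t| `^ q.

Lemma scaled_arg_gt0 p q t : 1 < p -> 0 < q -> 0 < t -> 0 < scaled_arg p q t.
Proof.
move=> p1 q0 t0; rewrite mulr_gt0 ?powR_gt0// divr_gt0// mulr_gt0; lra.
Qed.

Lemma scaled_arg_powR p q t : 1 < p -> 0 < q -> 0 < t ->
  scaled_arg p q t `^ p = p * (p + 1) * t / q.
Proof.
move=> p1 q0 t0; have p0 : 0 < p by lra.
have c0 : 0 < p * (p + 1) / q by rewrite divr_gt0// mulr_gt0; lra.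
rewrite /scaled_arg powRM ?powR_ge0// -!powRrM mulVf ?gt_eqF//.
by rewrite !powRr1 ?ltW//; ring.
Qed.

Lemma continuous_scaled_integrand p q : 1 < p -> 0 < q ->
  {in `]0, +oo[, continuous (scaled_integrand p q)}.
Proof.
move=> p1 q0 t; rewrite in_itv/= andbT => t0; apply: cvgM.
  exact: continuous_powR.
apply: (@continuous_comp _ _ _ (scaled_arg p q) (fun x => `|sin_p p x / x| `^ q)).
  by apply: cvgM; [exact: cvg_cst|exact: continuous_powR].
by apply: continuous_sinc_p_powR => //; rewrite in_itv/= scaled_arg_gt0.
Qed.

Lemma scaled_integrand_ge0 p q t : 0 <= scaled_integrand p q t.
Proof. by rewrite mulr_ge0 ?powR_ge0. Qed.

(** The prefactor q^(1/p) cancels the 1/q in the constant of the substitution, so no [q] remains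
    outside the integral. *)
Lemma I_p_scaled p q : 1 < p -> 0 < q ->
  (I_p p q = ((p * (p + 1)) `^ p^-1 * p^-1)%:E *
    \int[mu]_(t in `]0%R, +oo[) (scaled_integrand p q t)%:E)%E.
Proof.
move=> p1 q0; have p0 : 0 < p by lra.
have c0 : 0 < p * (p + 1) by rewrite mulr_gt0; lra.
have d0 : 0 < (p * (p + 1) / q) `^ p^-1 by rewrite powR_gt0// divr_gt0.
have a0 : 0 < p^-1 by rewrite invr_gt0.
rewrite /I_p (integral_powR_subst d0 a0 (continuous_sinc_p_powR p1 q0)); last first.
  by move=> x _; exact: powR_ge0.
pose k := (p * (p + 1) / q) `^ p^-1 * p^-1.
have E (t : R) : `|sin_p p (scaled_arg p q t) / scaled_arg p q t| `^ q *
    (k * t `^ (p^-1 - 1)) = k * scaled_integrand p q t.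
  by rewrite /scaled_integrand; ring.
rewrite /scaled_arg in E.
under eq_integral do rewrite E EFinM.
rewrite ge0_integralZl_EFin//.
- rewrite muleA -EFinM; congr (_%:E * _)%E.
  rewrite /k mulrA -powRM; [|exact: ltW|by apply: divr_ge0; exact: ltW].
  congr (_ `^ _ * _).
  by rewrite mulrC divfK// gt_eqF.
- by move=> t _; rewrite lee_fin scaled_integrand_ge0.
- apply/measurable_EFinP; apply: measurable_fun_0y.
  exact: (continuous_scaled_integrand p1 q0).
- by rewrite mulr_ge0// ltW.
Qed.

(** By [sin_p_ratio_bound] the ratio is at most (1 + w)^(- 2 r), where 2 p <= q gives r >= 1.
    Bernoulli then yields the decay 16 (1 + t)^(-2), uniformly in [q]. *)
Lemma scaled_integrand_le p q t : 1 < p -> 2 * p <= q -> 0 < t ->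
  scaled_integrand p q t <= 16 * (t `^ (p^-1 - 1) * (1 + t) `^ (- p^-1 - 1)).
Proof.
move=> p1 pq t0; have p0 : 0 < p by lra.
have q0 : 0 < q by lra.
rewrite mulrCA ler_wpM2l ?powR_ge0//.
set x := scaled_arg p q t; have x0 : 0 < x by exact: scaled_arg_gt0.
have xE : x `^ p = p * (p + 1) * t / q by exact: scaled_arg_powR.
(* The exponent 2 r of 1 + w is split by Bernoulli as ((1 + w)^r)^2. *)
pose r := q / (2 * p); pose w := x `^ p / (p + 2).
have r1 : 1 <= r by rewrite /r ler_pdivlMr; lra.
have w0 : 0 <= w by rewrite /w divr_ge0 ?powR_ge0; lra.
have rw : t / 4 <= r * w.
  have -> : r * w = t / 4 + t * p / (4 * (p + 2)).
    by rewrite /r /w xE; field; do ?(apply/andP; split); lra.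
  by rewrite lerDl divr_ge0// ?mulr_ge0; lra.
have qE : q = p * (r * 2) by rewrite /r; field; lra.
rewrite [in X in X <= _]qE powRrM.
apply: (@le_trans _ _ ((1 + w)^-1 `^ (r * 2))).
  apply: ge0_ler_powR; rewrite ?nnegrE ?powR_ge0 ?invr_ge0//; try lra.
  exact: sin_p_ratio_bound.
rewrite powRV; [rewrite (powRrM _ r 2)|lra].
have h1 : (1 + t) / 4 <= (1 + w) `^ r.
  by have := powR_bernoulli w0 r1; lra.
(* The exponent -2 is weakened to - 1/p - 1, for which the dominating function has an explicit
   primitive. *)
apply: (@le_trans _ _ (16 * (1 + t) `^ (- 2%:R))); last first.
  have a1 : p^-1 <= 1 by rewrite invf_le1// ltW.
  by rewrite ler_wpM2l//; apply: ler_powR; lra.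
rewrite powR_invn ?powR_mulrn ?powR_ge0//; last lra.
have -> : 16 * (1 + t) ^- 2 = (((1 + t) / 4) ^+ 2)^-1 by field; lra.
have h0 : 0 < (1 + t) / 4 by lra.
rewrite lef_pV2 ?posrE; [|by rewrite exprn_gt0 ?powR_gt0//; lra|exact: exprn_gt0].
by apply: lerXn2r; rewrite ?nnegrE ?powR_ge0 ?(ltW h0).
Qed.

(** A squeeze by [sin_p_ratio_powR_bounds]: the quantity q X / c there equals [t] for every q > 0,
    while X = c t / q tends to 0, so both exponents tend to - t. *)
Lemma cvg_scaled_integrand p t : 1 < p -> 0 < t ->
  scaled_integrand p q t @[q --> +oo] --> t `^ (p^-1 - 1) * expR (- t).
Proof.
move=> p1 t0; have p0 : 0 < p by lra.
pose c := p * (p + 1); have c0 : 0 < c by rewrite mulr_gt0; lra.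
have P0 := pi_p_gt0 p1.
pose X q := c * t / q.
have X0 : X q @[q --> +oo] --> 0.
  rewrite -[0](mulr0 (c * t)); apply: cvgM; first exact: cvg_cst.
  by apply/gtr0_cvgV0; [exact: nbhs_pinfty_gt|exact: cvg_id].
apply: cvgM; first exact: cvg_cst.
have cE (f : R -> R) l : f q @[q --> +oo] --> l ->
    expR (f q) @[q --> +oo] --> expR l.
  by move=> h; apply: continuous_cvg => //; exact: continuous_expR.
have c2 : 1 - 2 * X q @[q --> +oo] --> (1 - 2 * 0 : R).
  by apply: cvgB; [exact: cvg_cst|apply: cvgM => //; exact: cvg_cst].
apply: (@squeeze_cvgr _ _ _ _ (fun q => expR (- t / (1 - 2 * X q)))
  (fun q => expR (- t * expR (- (p * (X q / (c * (1 - 2 * X q))))) / (1 + X q / c)))).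
(* For large [q] the argument lies in the first quarter period and X < 1/2. *)
- near=> q.
  have q0 : 0 < q by near: q; exact: nbhs_pinfty_gt.
  have xE : scaled_arg p q t `^ p = X q by exact: scaled_arg_powR.
  have XP : X q <= (pi_p p / 2) `^ p.
    near: q; apply: (cvgr_le _ X0); by rewrite powR_gt0// divr_gt0.
  have X2 : X q < 2^-1.
    by near: q; apply: (cvgr_lt _ X0).
  have x0 := scaled_arg_gt0 p1 q0 t0.
  have xP : scaled_arg p q t <= pi_p p / 2.
    rewrite leNgt; apply/negP => h; suff : X q > (pi_p p / 2) `^ p by rewrite ltNge XP.
    rewrite -xE; apply: gt0_ltr_powR => //; rewrite nnegrE ?ltW//; lra.
  have := @sin_p_ratio_powR_bounds _ p q (scaled_arg p q t) p1 q0.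
  rewrite xE x0 xP -/c => /(_ isT X2).
  by have -> : q * X q / c = t by rewrite /X; field; rewrite !gt_eqF.
- have h : - t / (1 - 2 * X q) @[q --> +oo] --> (- t / (1 - 2 * 0) : R).
    apply: cvgM; first exact: cvg_cst.
    by apply: cvgV; [rewrite mulr0 subr0 oner_neq0|exact: c2].
  by have := cE _ _ h; rewrite mulr0 subr0 divr1.
- have h1 : - (p * (X q / (c * (1 - 2 * X q)))) @[q --> +oo] -->
      (- (p * (0 / (c * (1 - 2 * 0)))) : R).
    apply: cvgN; apply: cvgM; first exact: cvg_cst.
    apply: cvgM => //; apply: cvgV; first by rewrite mulr0 subr0 mulr1 gt_eqF.
    by apply: cvgM; [exact: cvg_cst|exact: c2].
  have h2 : - t * expR (- (p * (X q / (c * (1 - 2 * X q))))) / (1 + X q / c)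
      @[q --> +oo] -->
      (- t * expR (- (p * (0 / (c * (1 - 2 * 0))))) / (1 + 0 / c) : R).
    apply: cvgM; first by apply: cvgM; [exact: cvg_cst|exact: cE].
    apply: cvgV; first by rewrite mul0r addr0 oner_neq0.
    by apply: cvgD; [exact: cvg_cst|apply: cvgM => //; exact: cvg_cst].
  by have := cE _ _ h2; rewrite !mul0r mulr0 oppr0 expR0 addr0 divr1 mulr1.
Unshelve. all: by end_near. Qed.

Lemma cvg_integral_scaled p : 1 < p ->
  (\int[mu]_(t in `]0%R, +oo[) (scaled_integrand p q t)%:E @[q --> +oo%R] -->
   (Gamma p^-1)%:E)%E.
Proof.
move=> p1; have p0 : 0 < p by lra.
pose J q := (\int[mu]_(t in `]0%R, +oo[) (scaled_integrand p q t)%:E)%E.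
(* The domination requires 2 p <= q; the maximum enforces it everywhere and agrees with [q]
   eventually. *)
suff : J (Num.max q (2 * p)) @[q --> +oo] --> (Gamma p^-1)%:E.
  apply: cvg_trans; apply: near_eq_cvg; near=> q.
  by rewrite max_l//; near: q; exact: nbhs_pinfty_ge.
(* Dominated convergence is stated for sequences, so the limit is tested along each sequence tending
   to infinity. *)
apply/cvge_pinftyP => u uy.
pose v n := Num.max (u n) (2 * p).
have vp n : 2 * p <= v n by rewrite le_max lexx orbT.
have v0 n : 0 < v n by have := vp n; lra.
have vy : v n @[n --> \oo] --> +oo.
  apply/cvgryPge => A; near=> n; rewrite le_max; apply/orP; left.
  by near: n; apply: (cvgryPge _).1.
have cG : {in `]0, +oo[, continuous (fun t => t `^ (p^-1 - 1) * expR (- t))}.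
  move=> t; rewrite in_itv/= andbT => t0; apply: cvgM; first exact: continuous_powR.
  by apply: continuous_cvg; [exact: continuous_expR|apply: cvgN; exact: cvg_id].
have [|||||ig _ cv] := @dominated_convergence _ _ R mu `]0, +oo[%classic
  (measurable_itv _) (fun n t => (scaled_integrand p (v n) t)%:E)
  (fun t => (t `^ (p^-1 - 1) * expR (- t))%:E)
  (fun t => (16 * (t `^ (p^-1 - 1) * (1 + t) `^ (- p^-1 - 1)))%:E).
- move=> n; apply/measurable_EFinP; apply: measurable_fun_0y.
  exact: (continuous_scaled_integrand p1 (v0 n)).
- by apply/measurable_EFinP; exact: measurable_fun_0y.
- apply: aeW => t /=; rewrite in_itv/= andbT => t0.
  apply: cvg_EFin; first exact: nearW.
  have := cvg_scaled_integrand p1 t0.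
  by move/cvg_pinftyP; apply.
- have a0 : 0 < p^-1 by rewrite invr_gt0.
  apply: (@integrableZl _ _ R mu _ _ 16 _ (integrable_powR_0y a0)).
  exact: measurable_itv.
- apply: aeW => t /= n; rewrite in_itv/= andbT => t0.
  by rewrite ger0_norm ?scaled_integrand_ge0// lee_fin scaled_integrand_le.
have -> : (Gamma p^-1)%:E =
    (\int[mu]_(t in `]0%R, +oo[) (t `^ (p^-1 - 1) * expR (- t))%:E)%E.
  by rewrite /Gamma /Rintegral fineK//; exact: integrable_fin_num.
exact: cv.
Unshelve. all: by end_near. Qed.

End scaled_integrand.

Theorem theorem3p1 (R : realType) (p : R) (p_gt1 : 1 < p) :
  I_p p q @[q --> +oo] --> (p^-1 * Gamma p^-1 * (p * (p + 1)) `^ p^-1)%:E.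
Proof.
have -> : (p^-1 * Gamma p^-1 * (p * (p + 1)) `^ p^-1)%:E =
    (((p * (p + 1)) `^ p^-1 * p^-1)%:E * (Gamma p^-1)%:E)%E.
  by rewrite -EFinM; congr EFin; ring.
have := cvgeZl (isT : ((p * (p + 1)) `^ p^-1 * p^-1)%:E \is a fin_num)
  (cvg_integral_scaled p_gt1).
apply: cvg_trans; apply: near_eq_cvg; near=> q.
by rewrite I_p_scaled//; near: q; exact: nbhs_pinfty_gt.
Unshelve. all: by end_near. Qed.
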